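(* Let $A \in \mathbb{R}^{n\times m}$ and let $S \geq 1$ be an integer such that the restricted isometry constants of $A$ satisfy $\delta_{3S} + 3\,\delta_{4S} < 2$. Let $\epsilon \ge 0$. Let $x_0$ be an arbitrary vector in $\mathbb{R}^m$, let $x_{0,S}$ be the truncated vector corresponding to the $S$ largest values of $x_0$ (in absolute value), let $e\in\mathbb{R}^n$ be any perturbation with $\|e\|_{\ell_2}\leq \epsilon$, and set $y = Ax_0 + e$. Then any solution $x^\sharp$ to the convex program $$(P_2)\qquad \min_{x\in\mathbb{R}^m}\ \|x\|_{\ell_1} \quad\text{subject to}\quad \|Ax-y\|_{\ell_2} \leq \epsilon$$ obeys $$\|x^\sharp - x_0\|_{\ell_2} \leq C_{1,S}\cdot \epsilon + C_{2,S}\cdot \frac{\|x_0 - x_{0,S}\|_{\ell_1}}{\sqrt{S}},$$ where the constants $C_{1,S}$ and $C_{2,S}$ may only depend on $\delta_{4S}$. For reasonable values of $\delta_{4S}$ these constants are well behaved; e.g. one has $C_{1,S}\approx 12.04$ and $C_{2,S}\approx 8.77$ for $\delta_{4S} = 1/5$.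
   Context: For $T\subset\{1,\ldots,m\}$, $A_T$ denotes the $n\times |T|$ submatrix obtained by extracting the columns of $A$ corresponding to the indices in $T$. For a positive integer $k$, the $k$-restricted isometry constant $\delta_k$ of $A$ is the smallest quantity such that $$(1-\delta_k)\,\|c\|_{\ell_2}^2 \leq \|A_T c\|_{\ell_2}^2 \leq (1+\delta_k)\,\|c\|_{\ell_2}^2$$ for all subsets $T\subset\{1,\ldots,m\}$ with $|T|\leq k$ and all real coefficient sequences $c = (c_j)_{j\in T}$. The vector $x_{0,S}$ agrees with $x_0$ on a set of $S$ indices at which $|x_0|$ takes its $S$ largest values (ties broken arbitrarily) and is zero elsewhere. Here $\|\cdot\|_{\ell_1}$ and $\|\cdot\|_{\ell_2}$ are the usual $\ell_1$ and Euclidean norms. That $C_{1,S}$ and $C_{2,S}$ may only depend on $\delta_{4S}$ means that they are determined by the value of $\delta_{4S}$ and do not otherwise depend on $A$, $n$, $m$, $x_0$, $e$ or $\epsilon$. *)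

(* Defs.v *)
From mathcomp Require Import all_boot all_order all_algebra.
From mathcomp Require Import boolp classical_sets reals.

Set Implicit Arguments.
Unset Strict Implicit.
Unset Printing Implicit Defensive.

Import Order.TTheory GRing.Theory Num.Theory.
Local Open Scope ring_scope.

Section Definitions.
Variable R : realType.

Definition l1norm (p : nat) (x : 'cV[R]_p) : R := \sum_i `|x i 0|.

Definition l2norm (p : nat) (x : 'cV[R]_p) : R :=
  Num.sqrt (\sum_i x i 0 ^+ 2).

Definition extract_cols (n m : nat) (A : 'M[R]_(n, m)) (T : {set 'I_m}) :
    'M[R]_(n, #|T|) :=
  colsub (fun j : 'I_#|T| => enum_val j) A.

Definition rip (n m : nat) (A : 'M[R]_(n, m)) (k : nat) (d : R) : Prop :=
  forall (T : {set 'I_m}) (c : 'cV[R]_#|T|), (#|T| <= k)%N ->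
    (1 - d) * l2norm c ^+ 2 <= l2norm (extract_cols A T *m c) ^+ 2 /\
    l2norm (extract_cols A T *m c) ^+ 2 <= (1 + d) * l2norm c ^+ 2.

(* For 0 < m and 0 < k the infimum is attained, see [ricP]; when m = 0 or k = 0
   every real satisfies [rip A k] and the value is the default [inf] = 0. *)
Definition ric (n m : nat) (A : 'M[R]_(n, m)) (k : nat) : R :=
  inf [set d : R | rip A k d]%classic.

(* Ties are broken arbitrarily, hence a relation. [minn s m] only matters when
   s > m, where the truncation is x itself. *)
Definition is_truncation (m s : nat) (x xs : 'cV[R]_m) : Prop :=
  exists T : {set 'I_m},
    [/\ #|T| = minn s m,
        (forall i j, i \in T -> j \notin T -> `|x j 0| <= `|x i 0|) &
        xs = \col_i (if i \in T then x i 0 else 0)].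

Definition P2_feasible (n m : nat) (A : 'M[R]_(n, m)) (y : 'cV[R]_n) (eps : R)
    (x : 'cV[R]_m) : Prop :=
  l2norm (A *m x - y) <= eps.

Definition P2_solution (n m : nat) (A : 'M[R]_(n, m)) (y : 'cV[R]_n) (eps : R)
    (x : 'cV[R]_m) : Prop :=
  P2_feasible A y eps x /\
  forall z : 'cV[R]_m, P2_feasible A y eps z -> l1norm x <= l1norm z.

End Definitions.

Section RestrictedIsometryConstant.
Variables (R : realType) (n m : nat) (A : 'M[R]_(n, m)) (k : nat).

Lemma l2norm_sqr (p : nat) (x : 'cV[R]_p) :
  l2norm x ^+ 2 = \sum_i x i 0 ^+ 2.
Proof. by rewrite sqr_sqrtr // sumr_ge0 // => i _; rewrite sqr_ge0. Qed.

Lemma normr_le_l2norm (p : nat) (x : 'cV[R]_p) (j : 'I_p) :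
  `|x j 0| <= l2norm x.
Proof.
rewrite -sqrtr_sqr ler_wsqrtr // (bigD1 j) //= lerDl.
by rewrite sumr_ge0 // => i _; rewrite sqr_ge0.
Qed.

Lemma rip_exists : exists d : R, rip A k d.
Proof.
pose M := \sum_i (\sum_j `|A i j|) ^+ 2.
have M0 : 0 <= M by rewrite sumr_ge0 // => i _; rewrite sqr_ge0.
exists (1 + M) => T c _; split.
  apply: (@le_trans _ _ 0); last exact: sqr_ge0.
  by rewrite mulr_le0_ge0 ?sqr_ge0 // opprD addrA subrr add0r oppr_le0.
apply: (@le_trans _ _ (M * l2norm c ^+ 2)); last first.
  by rewrite ler_wpM2r ?sqr_ge0 // addrA lerDr addr_ge0.
rewrite [leLHS]l2norm_sqr mulr_suml ler_sum // => i _.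
rewrite -exprMn -real_normK ?num_real // lerXn2r ?nnegrE //.
  by rewrite mulr_ge0 ?sqrtr_ge0 ?sumr_ge0.
rewrite mxE (le_trans (ler_norm_sum _ _ _)) //.
apply: (@le_trans _ _ (\sum_(j < #|T|) `|A i (enum_val j)| * l2norm c)).
  by rewrite ler_sum // => j _; rewrite mxE normrM ler_wpM2l ?normr_le_l2norm.
rewrite -mulr_suml ler_wpM2r ?sqrtr_ge0 //.
rewrite -(big_enum_val (fun j => `|A i j|)) /=.
by rewrite [leRHS](bigID (fun j => j \in T)) /= lerDl sumr_ge0.
Qed.

Lemma ricP : (0 < m)%N -> (0 < k)%N ->
  rip A k (ric A k) /\ forall d : R, rip A k d -> ric A k <= d.
Proof.
move=> m0 k0; set E := [set d : R | rip A k d]%classic.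
have E0 : (E !=set0)%classic by have [d] := rip_exists; exists d.
have Elb : has_lbound E.
  exists 0 => d Ed; pose T := [set Ordinal m0]%SET.
  have T1 : #|T| = 1%N by rewrite cards1.
  have Tk : (#|T| <= k)%N by rewrite T1.
  have [] := Ed T (const_mx 1) Tk.
  have -> : l2norm (const_mx 1 : 'cV[R]_#|T|) ^+ 2 = 1.
    rewrite l2norm_sqr (eq_bigr (fun=> 1)) => [|i _]; last by rewrite mxE expr1n.
    by rewrite sumr_const card_ord T1.
  rewrite !mulr1 => h1 h2; have := le_trans h1 h2.
  by rewrite lerD2l -subr_ge0 opprK -mulr2n pmulrn_lge0.
split; last by move=> d Ed; apply: ge_inf.
move=> T c Tk; set N := l2norm c ^+ 2; set Q := l2norm _ ^+ 2.
have [N0|N0] := eqVneq N 0.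
  have [d Ed] := E0; have := Ed T c Tk; by rewrite -/N -/Q N0 !mulr0.
have Np : 0 < N by rewrite lt_def N0 sqr_ge0.
split.
- rewrite -ler_pdivlMr // lerBlDl -lerBlDr.
  apply: lb_le_inf => // d /(_ T c Tk)[+ _].
  by rewrite -/N -/Q -ler_pdivlMr // lerBlDl -lerBlDr.
- rewrite -ler_pdivrMr // -lerBlDl.
  apply: lb_le_inf => // d /(_ T c Tk)[_ +].
  by rewrite -/N -/Q -ler_pdivrMr // -lerBlDl.
Qed.

End RestrictedIsometryConstant.

(* Main.v *)
(** Let [h] be the error, [T0] the support of the truncation, [T1] the [3 * S]
largest entries of [h] off [T0], and cut the rest into successive blocks of
size [3 * S].  The [l2] norm of a block is at most the [l1] norm of the previous
one over [sqrt (3 * S)], so what lies beyond [T1] is controlled by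
[|h_T0^c|_1 / sqrt (3 * S)], and minimality of the solution bounds this by
[(|h_T0|_2 + 2 * |x0 - x0S|_1 / sqrt S) / sqrt 3].  The triangle inequality for
[A h] then bounds [h] on [T0 :|: T1], with a factor
[1 / (sqrt (1 - delta_4S) - sqrt ((1 + delta_3S) / 3))].

Replacing [delta_3S] by [delta_4S] makes this factor depend on [delta_4S] only,
but it stays positive only for [delta_4S < 1/2].  When [delta_4S >= 1/2] the
hypothesis gives [1 - delta_3S > 3 * delta_4S - 1 >= delta_4S], and one
distinguishes two cases.  If [|h_T1| >= |h_T0| / 3], then [|h_T0|] is smaller
than [|h_(T0 u T1)|] by a definite factor and the triangle inequality has room
to spare.  Otherwise one expands [<A h_T0, A h>] and uses
[|<A h_T0, A h_Tj>| <= delta_4S |h_T0| |h_Tj|]: as [1/3 + 1/sqrt 3 < 1], the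
cross terms are absorbed by [(1 - delta_3S) |h_T0|^2].  Both cases yield
absolute constants. *)

Require Import Defs.
From mathcomp Require Import all_boot all_order all_algebra.
From mathcomp Require Import boolp classical_sets reals.
(* [fintype] and [finset] come last so that [subsetP], [set0], etc. refer to
   finite sets and not to [classical_sets]. *)
From mathcomp Require Import ring lra fintype finset.

Set Implicit Arguments.
Unset Strict Implicit.
Unset Printing Implicit Defensive.

Import Order.TTheory GRing.Theory Num.Theory.
Local Open Scope ring_scope.

(** * Inner product, Cauchy-Schwarz, and restriction to an index set *)

Section Euclidean.
Context {R : realType}.

Definition dot {p : nat} (u v : 'cV[R]_p) : R := \sum_i u i 0 * v i 0.

Lemma dotDl p (u v w : 'cV[R]_p) : dot (u + v) w = dot u w + dot v w.
Proof.
by rewrite /dot -big_split; apply: eq_bigr => i _; rewrite mxE mulrDl.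
Qed.

Lemma dotC p (u v : 'cV[R]_p) : dot u v = dot v u.
Proof. by apply: eq_bigr => i _; rewrite mulrC. Qed.

Lemma dotDr p (u v w : 'cV[R]_p) : dot u (v + w) = dot u v + dot u w.
Proof. by rewrite dotC dotDl !(dotC u). Qed.

Lemma dotZl p c (u v : 'cV[R]_p) : dot (c *: u) v = c * dot u v.
Proof. by rewrite /dot mulr_sumr; apply: eq_bigr => i _; rewrite mxE mulrA. Qed.

Lemma dotZr p c (u v : 'cV[R]_p) : dot u (c *: v) = c * dot u v.
Proof. by rewrite dotC dotZl dotC. Qed.

Lemma dot0l p (u : 'cV[R]_p) : dot 0 u = 0.
Proof. by rewrite -(scale0r 0) dotZl mul0r. Qed.

Lemma l2norm_sqr_dot p (u : 'cV[R]_p) : l2norm u ^+ 2 = dot u u.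
Proof. by rewrite l2norm_sqr; apply: eq_bigr => i _; rewrite expr2. Qed.

Lemma l2norm_ge0 p (u : 'cV[R]_p) : 0 <= l2norm u.
Proof. exact: sqrtr_ge0. Qed.

Lemma l2norm_eq0 p (u : 'cV[R]_p) : l2norm u = 0 -> u = 0.
Proof.
move=> u0; apply/matrixP => i j; rewrite ord1 mxE; apply/eqP.
by rewrite -normr_le0 -u0 normr_le_l2norm.
Qed.

Lemma l2norm0 p : l2norm (0 : 'cV[R]_p) = 0.
Proof. by apply/eqP; rewrite -sqrf_eq0 l2norm_sqr_dot dot0l. Qed.

Lemma l2normN p (u : 'cV[R]_p) : l2norm (- u) = l2norm u.
Proof. by congr Num.sqrt; apply: eq_bigr => i _; rewrite mxE sqrrN. Qed.

(** With [a = |u|] and [b = |v|], expanding [0 <= |b u - a v|^2] gives [0 <= 2ab (ab - <u,v>)]. *)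
Lemma dot_le p (u v : 'cV[R]_p) : dot u v <= l2norm u * l2norm v.
Proof.
have [u0|u0] := eqVneq (l2norm u) 0.
  by rewrite (l2norm_eq0 u0) dot0l l2norm0 mul0r.
have [v0|v0] := eqVneq (l2norm v) 0.
  by rewrite (l2norm_eq0 v0) dotC dot0l l2norm0 mulr0.
set a := l2norm u in u0 *; set b := l2norm v in v0 *.
have ab : 0 < a * b by rewrite mulr_gt0 // lt_def ?u0 ?v0 l2norm_ge0.
have := sqr_ge0 (l2norm (b *: u + (- a) *: v)).
rewrite l2norm_sqr_dot !(dotDl, dotDr, dotZl, dotZr) (dotC v u).
rewrite -!l2norm_sqr_dot -/a -/b => H.
by rewrite -(ler_pM2l ab); lra.
Qed.

Lemma l2normD p (u v : 'cV[R]_p) : l2norm (u + v) <= l2norm u + l2norm v.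
Proof.
rewrite -[leLHS]ger0_norm ?l2norm_ge0 // -ler_sqr ?nnegrE ?addr_ge0 ?l2norm_ge0 //.
rewrite ger0_norm ?l2norm_ge0 // l2norm_sqr_dot !(dotDl, dotDr) (dotC v u).
rewrite -!l2norm_sqr_dot; have := dot_le u v; lra.
Qed.

Definition restr {p : nat} (T : {set 'I_p}) (u : 'cV[R]_p) : 'cV[R]_p :=
  \col_i (if i \in T then u i 0 else 0).

Definition supported {p : nat} (T : {set 'I_p}) (u : 'cV[R]_p) : Prop :=
  forall i, i \notin T -> u i 0 = 0.

Lemma supported_restr p (T : {set 'I_p}) (u : 'cV[R]_p) :
  supported T (restr T u).
Proof. by move=> i /negbTE iT; rewrite mxE iT. Qed.

Lemma restr0 p (u : 'cV[R]_p) : restr set0 u = 0.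
Proof. by apply/matrixP => i j; rewrite !mxE inE. Qed.

Lemma restr_setD p (T U : {set 'I_p}) (u : 'cV[R]_p) :
  T \subset U -> restr U u = restr T u + restr (U :\: T) u.
Proof.
move=> /subsetP TU; apply/matrixP => i j; rewrite !mxE inE.
by case: (boolP (i \in T)) => [/TU ->|_] /=; rewrite ?addr0 ?add0r.
Qed.

Lemma dot_disjoint p (T U : {set 'I_p}) (u v : 'cV[R]_p) :
  [disjoint T & U] -> supported T u -> supported U v -> dot u v = 0.
Proof.
move=> TU uT vU; apply: big1 => i _.
have [iT|/uT ->] := boolP (i \in T); last by rewrite mul0r.
by rewrite vU ?mulr0 //; move/pred0P/(_ i): TU => /=; rewrite iT => /= ->.
Qed.

Lemma l2norm_restr_sqr p (T : {set 'I_p}) (u : 'cV[R]_p) :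
  l2norm (restr T u) ^+ 2 = \sum_(i in T) u i 0 ^+ 2.
Proof.
rewrite l2norm_sqr [RHS]big_mkcond; apply: eq_bigr => i _; rewrite mxE.
by case: ifP; rewrite ?expr0n.
Qed.

(** Cauchy-Schwarz against the sign vector of [u] on [T]. *)
Lemma l1_le_l2 p (T : {set 'I_p}) (u : 'cV[R]_p) (k : nat) : (#|T| <= k)%N ->
  \sum_(i in T) `|u i 0| <= Num.sqrt k%:R * l2norm (restr T u).
Proof.
move=> Tk; pose s : 'cV[R]_p := \col_i (if i \in T then Num.sg (u i 0) else 0).
have -> : \sum_(i in T) `|u i 0| = dot s (restr T u).
  rewrite big_mkcond; apply: eq_bigr => i _; rewrite !mxE.
  by case: ifP; rewrite ?mul0r // -normrEsg.
apply: le_trans (dot_le _ _) _; rewrite ler_wpM2r ?l2norm_ge0 //.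
apply: ler_wsqrtr; apply: (@le_trans _ _ (\sum_(i in T) 1)); last first.
  by rewrite sumr_const ler_nat.
rewrite [leRHS]big_mkcond; apply: ler_sum => i _; rewrite mxE.
case: ifP => _; last by rewrite expr0n.
by rewrite sqr_sg lern1 leq_b1.
Qed.

End Euclidean.

(** * Consequences of the restricted isometry property *)

Section RestrictedIsometry.
Context {R : realType} {n m : nat}.
Variable A : 'M[R]_(n, m).

(** Trades column submatrices for sparse vectors of full length, which can be added across different
    supports. *)
Lemma rip_supported (k : nat) (d : R) (T : {set 'I_m}) (v : 'cV[R]_m) :
  rip A k d -> (#|T| <= k)%N -> supported T v ->
  (1 - d) * l2norm v ^+ 2 <= l2norm (A *m v) ^+ 2 /\
  l2norm (A *m v) ^+ 2 <= (1 + d) * l2norm v ^+ 2.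
Proof.
move=> Ad Tk vT; pose c : 'cV[R]_#|T| := \col_j v (enum_val j) 0.
have sumT (f : 'I_m -> R) : (forall i, i \notin T -> f i = 0) ->
    \sum_(j < #|T|) f (enum_val j) = \sum_i f i.
  move=> f0; rewrite -(big_enum_val f) /= big_mkcond.
  by apply: eq_bigr => i _; case: ifPn => // /f0 ->.
have -> : A *m v = extract_cols A T *m c.
  apply/matrixP => i j; rewrite ord1 !mxE -sumT => [|l lT]; last first.
    by rewrite vT // mulr0.
  by apply: eq_bigr => l _; rewrite !mxE.
have -> : l2norm v = l2norm c; last exact: Ad.
congr Num.sqrt; rewrite -sumT => [|i iT]; last by rewrite vT // expr0n.
by apply: eq_bigr => l _; rewrite mxE.
Qed.

(** A coordinate vector gives [1 - d <= 1 + d]. *)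
Lemma rip_ge0 (k : nat) (d : R) : (0 < m)%N -> (0 < k)%N -> rip A k d -> 0 <= d.
Proof.
move=> m0 k0 Ad; pose i := Ordinal m0; pose v : 'cV[R]_m := delta_mx i 0.
have v1 : l2norm v ^+ 2 = 1.
  rewrite l2norm_sqr (bigD1 i) //= big1 => [|j ji]; rewrite mxE !eqxx ?addr0 ?expr1n //.
  by rewrite (negbTE ji) expr0n.
have vi : supported [set i] v.
  by move=> j; rewrite inE mxE => /negbTE ->.
have [] := rip_supported Ad (_ : #|[set i]| <= k)%N vi; first by rewrite cards1.
by rewrite v1; lra.
Qed.

Lemma rip_le_norm (k : nat) (d : R) (T : {set 'I_m}) (v : 'cV[R]_m) :
  rip A k d -> (#|T| <= k)%N -> supported T v ->
  l2norm (A *m v) <= Num.sqrt (1 + d) * l2norm v.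
Proof.
move=> Ad Tk vT; have [_ H] := rip_supported Ad Tk vT.
have [d1|d1] := leP 0 (1 + d).
  rewrite -ler_sqr ?nnegrE ?mulr_ge0 ?sqrtr_ge0 ?l2norm_ge0 //.
  by rewrite exprMn (sqr_sqrtr d1).
(* For [1 + d < 0] the upper isometry bound forces [A v = 0]. *)
have -> : l2norm (A *m v) = 0; last by rewrite mulr_ge0 ?sqrtr_ge0 ?l2norm_ge0.
apply/eqP; rewrite -sqrf_eq0 eq_le sqr_ge0 andbT (le_trans H) //.
by rewrite mulr_le0_ge0 ?sqr_ge0 // ltW.
Qed.

Lemma rip_ge_norm (k : nat) (d : R) (T : {set 'I_m}) (v : 'cV[R]_m) :
  rip A k d -> (#|T| <= k)%N -> supported T v ->
  Num.sqrt (1 - d) * l2norm v <= l2norm (A *m v).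
Proof.
move=> Ad Tk vT; have [H _] := rip_supported Ad Tk vT.
have [d1|/ltW d1] := leP 0 (1 - d); last by rewrite ler0_sqrtr // mul0r l2norm_ge0.
rewrite -ler_sqr ?nnegrE ?mulr_ge0 ?sqrtr_ge0 ?l2norm_ge0 //.
by rewrite exprMn (sqr_sqrtr d1).
Qed.

(* Polarization applied to the rescaled vectors [b *: u] and [a *: v], which
   have the same norm. *)
Lemma rip_cross (k : nat) (d : R) (T U : {set 'I_m}) (u v : 'cV[R]_m) :
  rip A k d -> (#|T :|: U| <= k)%N -> [disjoint T & U] ->
  supported T u -> supported U v ->
  - dot (A *m u) (A *m v) <= d * l2norm u * l2norm v.
Proof.
move=> Ad TUk TU uT vU.
have [u0|u0] := eqVneq (l2norm u) 0.
  by rewrite (l2norm_eq0 u0) mulmx0 dot0l l2norm0 mulr0 mul0r oppr0.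
have [v0|v0] := eqVneq (l2norm v) 0.
  by rewrite (l2norm_eq0 v0) mulmx0 dotC dot0l l2norm0 mulr0 oppr0.
set a := l2norm u in u0 *; set b := l2norm v in v0 *.
have ab : 0 < a * b by rewrite mulr_gt0 // lt_def ?u0 ?v0 l2norm_ge0.
have sup x y : supported (T :|: U) (x *: u + y *: v).
  move=> i; rewrite inE negb_or => /andP[iT iU].
  by rewrite !mxE uT // vU // !mulr0 addr0.
have uv0 := dot_disjoint TU uT vU.
have [H1 _] := rip_supported Ad TUk (sup b a).
have [_ H2] := rip_supported Ad TUk (sup b (- a)).
move: H1 H2; rewrite !mulmxDr -!scalemxAr !l2norm_sqr_dot.
rewrite !(dotDl, dotDr, dotZl, dotZr) (dotC v u) uv0.
rewrite (dotC (A *m v) (A *m u)) -!l2norm_sqr_dot -/a -/b => H1 H2.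
by rewrite -(ler_pM2l ab); lra.
Qed.

End RestrictedIsometry.

(** * Sorting into blocks of decreasing magnitude *)

Section Shelling.
Context {R : realType} {p : nat}.
Variable h : 'cV[R]_p.

Definition top_set (k : nat) (U T : {set 'I_p}) : Prop :=
  [/\ T \subset U, #|T| = minn k #|U| &
      forall i j, i \in T -> j \in U :\: T -> `|h j 0| <= `|h i 0|].

(** Greedy choice: each step adds a largest remaining entry, until [U] is exhausted. *)
Lemma top_setP (k : nat) (U : {set 'I_p}) : exists T, top_set k U T.
Proof.
elim: k => [|k [T [TU cT hT]]].
  by exists set0; split; [exact: sub0set | rewrite cards0 min0n | move=> i j; rewrite inE].
have [UT|[i0 i0U]] := set_0Vmem (U :\: T).
  have UTe : U = T by apply/eqP; rewrite eqEsubset TU andbT -setD_eq0 UT.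
  exists T; split => //; rewrite -UTe; apply/esym/minn_idPr.
  by rewrite -UTe in cT; move: (geq_minl k #|U|); rewrite -cT => /leqW.
have [i iU imax] := Order.TotalTheory.arg_maxP (fun i => `|h i 0|) i0U.
have /andP[iT iU'] : (i \notin T) && (i \in U) by rewrite -in_setD.
have kU : (k < #|U|)%N.
  rewrite ltnNge; apply/negP => Uk; move: cT; rewrite (minn_idPr Uk) => cT.
  have := subset_leqif_cards TU; rewrite cT => -[_ /esym]; rewrite eqxx.
  by move=> /eqP TUe; rewrite TUe iU' in iT.
exists (i |: T); split.
- by rewrite subUset sub1set iU' TU.
- by rewrite cardsU1 iT cT (minn_idPl kU) (minn_idPl (ltnW kU)) add1n.
move=> l j; rewrite !inE negb_or => /orP[/eqP ->|lT] /andP[/andP[ji jT] jU].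
  by apply: imax; change (j \in U :\: T); rewrite inE jT jU.
by apply: hT => //; rewrite inE jT jU.
Qed.

(** Each entry on [U] is at most the average over [T], and [U] has at most [M] entries. *)
Lemma l2norm_next_block (M : nat) (T U : {set 'I_p}) : (0 < M)%N ->
  #|T| = M -> (#|U| <= M)%N ->
  (forall i j, i \in T -> j \in U -> `|h j 0| <= `|h i 0|) ->
  l2norm (restr U h) <= (\sum_(i in T) `|h i 0|) / Num.sqrt M%:R.
Proof.
move=> M0 cT cU hTU; set s := \sum_(i in T) _.
have s0 : 0 <= s by rewrite sumr_ge0.
have MR : 0 < M%:R :> R by rewrite ltr0n.
have hs j : j \in U -> `|h j 0| <= s / M%:R.
  move=> jU; rewrite ler_pdivlMr // mulr_natr -cT -sumr_const.
  by apply: ler_sum => i iT; apply: hTU.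
rewrite -ler_sqr ?nnegrE ?divr_ge0 ?sqrtr_ge0 ?l2norm_ge0 //.
rewrite l2norm_restr_sqr expr_div_n sqr_sqrtr ?ler0n //.
apply: (@le_trans _ _ (\sum_(i in U) (s / M%:R) ^+ 2)).
  apply: ler_sum => i iU; rewrite -real_normK ?num_real //.
  by rewrite ler_sqr ?nnegrE ?divr_ge0 ?ler0n // hs.
rewrite sumr_const -[leLHS]mulr_natr expr_div_n.
have -> : s ^+ 2 / M%:R = s ^+ 2 / M%:R ^+ 2 * M%:R.
  by field; rewrite gt_eqF.
by rewrite ler_wpM2l ?divr_ge0 ?sqr_ge0 // ler_nat.
Qed.

(* Stated for a general subadditive [f] because it is applied to [l2norm], to
   [l2norm (A *m _)] and to [- dot (A *m u) (A *m _)]. *)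
Lemma shelling_bound (M : nat) (U0 : {set 'I_p}) (f : 'cV[R]_p -> R) (K : R) :
  (0 < M)%N -> 0 <= K -> f 0 <= 0 ->
  (forall u v, f (u + v) <= f u + f v) ->
  (forall (T : {set 'I_p}) v, T \subset U0 -> (#|T| <= M)%N -> supported T v ->
     f v <= K * l2norm v) ->
  forall U T : {set 'I_p}, U \subset U0 -> top_set M U T ->
  f (restr (U :\: T) h) <= K * ((\sum_(i in U) `|h i 0|) / Num.sqrt M%:R).
Proof.
(* Induction on a bound for the size of [U]: removing the top block leaves a smaller set. *)
move=> M0 K0 f0 fD fK U; move: {2}#|U| (leqnn #|U|) => N.
have RHS0 (V : {set 'I_p}) : 0 <= K * ((\sum_(i in V) `|h i 0|) / Num.sqrt M%:R).
  by rewrite mulr_ge0 // divr_ge0 ?sqrtr_ge0 // sumr_ge0.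
elim: N U => [|N IH] U UN T UU0 topT.
  move: UN; rewrite leqn0 cards_eq0 => /eqP ->.
  by rewrite set0D restr0; apply: le_trans f0 (RHS0 _).
have [TU cT hT] := topT.
have [->|[i0 i0U]] := set_0Vmem (U :\: T).
  by rewrite restr0; apply: le_trans f0 (RHS0 _).
have TltU : (#|T| < #|U|)%N.
  by apply: proper_card; rewrite properE TU /=; apply/subsetPn; exists i0;
    move: i0U; rewrite inE => /andP[].
(* As something remains outside [T], the block [T] is full. *)
have cTM : #|T| = M.
  move: cT TltU; rewrite /minn; case: ifP => // _ ->; by rewrite ltnn.
have [T2 topT2] := top_setP M (U :\: T); have [T2U cT2 hT2] := topT2.
have UTU0 : U :\: T \subset U0 by apply: subset_trans UU0; exact: subsetDl.
have T2M : (#|T2| <= M)%N by rewrite cT2 geq_minl.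
rewrite (restr_setD _ T2U); apply: le_trans (fD _ _) _.
have UTN : (#|U :\: T| <= N)%N.
  rewrite -ltnS (leq_trans _ UN) // cardsD (setIidPr TU).
  by rewrite ltn_subrL cTM M0 /=; apply: leq_ltn_trans TltU.
have H1 := IH _ UTN _ UTU0 topT2.
(* The block [T2] is charged to the [l1] mass of [T], the later ones to that of [U :\: T]; together
   these make up the mass of [U]. *)
have H2 : f (restr T2 h) <= K * ((\sum_(i in T) `|h i 0|) / Num.sqrt M%:R).
  apply: (@le_trans _ _ (K * l2norm (restr T2 h))).
    by apply: (fK T2); [apply: subset_trans T2U UTU0 | | exact: supported_restr].
  rewrite ler_wpM2l // l2norm_next_block // => i j iT jT2; apply: hT => //.
  exact: (subsetP T2U).
apply: le_trans (lerD H2 H1) _; rewrite -mulrDr -mulrDl.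
by rewrite [X in _ <= _ * (X / _)](big_setID T) /= (setIidPr TU).
Qed.

End Shelling.

(** * Decomposition of the error vector *)

Section Blocks.
Context {R : realType} {n m : nat}.
Variables (A : 'M[R]_(n, m)) (S : nat) (d3 d4 : R).

(** Here [v] carries the [3 * S] largest entries off [T0], [w] the rest. [T0] and one block fit in
    [4 * S] indices, so [d4] governs [u + v] and the pairing of [u] with any block, while [d3]
    governs single blocks. The last bound assumes [0 <= d4] because shelling needs a nonnegative
    factor. *)
Lemma block_decomposition (T0 : {set 'I_m}) (h : 'cV[R]_m) :
  (0 < S)%N -> rip A (3 * S) d3 -> rip A (4 * S) d4 -> (#|T0| <= S)%N ->
  let L := (\sum_(i in ~: T0) `|h i 0|) / Num.sqrt (3 * S)%:R in
  let u := restr T0 h in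
  exists v w : 'cV[R]_m,
    h = u + v + w /\
    l2norm (u + v) ^+ 2 = l2norm u ^+ 2 + l2norm v ^+ 2 /\
    l2norm w <= L /\
    l2norm (A *m w) <= Num.sqrt (1 + d3) * L /\
    Num.sqrt (1 - d4) * l2norm (u + v) <= l2norm (A *m (u + v)) /\
    - dot (A *m u) (A *m v) <= d4 * l2norm u * l2norm v /\
    (0 <= d4 -> - dot (A *m u) (A *m w) <= d4 * l2norm u * L).
Proof.
move=> S0 A3 A4 T0S L u.
have [T1 topT1] := top_setP h (3 * S) (~: T0).
have M0 : (0 < 3 * S)%N by rewrite muln_gt0.
have [T1U cT1 _] := topT1.
have T1M : (#|T1| <= 3 * S)%N by rewrite cT1 geq_minl.
have disj (T : {set 'I_m}) : T \subset ~: T0 -> [disjoint T0 & T].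
  by rewrite disjoint_sym disjoints_subset.
have cU (T : {set 'I_m}) : (#|T| <= 3 * S)%N -> (#|T0 :|: T| <= 4 * S)%N.
  move=> TM; apply: (leq_trans (leq_card_setU _ _)).
  by apply: (leq_trans (leq_add T0S TM)); rewrite -mulSn.
have shell := fun f K => @shelling_bound R m h (3 * S) (~: T0) f K M0.
pose v := restr T1 h; pose w := restr (~: T0 :\: T1) h.
have uS : supported T0 u by exact: supported_restr.
have vS : supported T1 v by exact: supported_restr.
exists v, w.
split; last split; last split; last split; last split; last split.
- rewrite -addrA -(restr_setD _ T1U) -setTD -restr_setD ?subsetT //.
  by apply/matrixP => i j; rewrite ord1 mxE inE.
- rewrite !l2norm_sqr_dot !(dotDl, dotDr) (dotC v u).
  by rewrite (dot_disjoint (disj _ T1U) uS vS); ring.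
- rewrite -[L]mul1r; apply: shell topT1 => //; rewrite ?l2norm0 //.
    exact: l2normD.
  by move=> *; rewrite mul1r.
- apply: (shell (fun x => l2norm (A *m x))) topT1 => //=.
  + by rewrite sqrtr_ge0.
  + by rewrite mulmx0 l2norm0.
  + by move=> x z; rewrite mulmxDr l2normD.
  + by move=> T x _; apply: rip_le_norm.
- apply: (rip_ge_norm A4 (cU _ T1M)) => i; rewrite inE negb_or => /andP[i0 i1].
  by rewrite mxE uS // vS // addr0.
- exact: rip_cross A4 (cU _ T1M) (disj _ T1U) uS vS.
move=> d40; apply: (shell (fun x => - dot (A *m u) (A *m x))) topT1 => //=.
- by rewrite mulr_ge0 ?l2norm_ge0.
- by rewrite mulmx0 dotC dot0l oppr0.
- by move=> x z; rewrite mulmxDr dotDr opprD.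
- by move=> T x TU TM xT; apply: rip_cross A4 (cU _ TM) (disj _ TU) uS xT.
Qed.

End Blocks.

(** * Consequences of feasibility and [l1] minimality *)

Section Program.
Context {R : realType}.

Lemma P2_tube n m (A : 'M[R]_(n, m)) (x0 x : 'cV[R]_m)
    (e y : 'cV[R]_n) (eps : R) :
  l2norm e <= eps -> y = A *m x0 + e -> P2_solution A y eps x ->
  l2norm (A *m (x - x0)) <= 2 * eps.
Proof.
move=> ee yE [fx _].
have -> : A *m (x - x0) = (A *m x - y) + e.
  by rewrite yE mulmxBr opprD addrA subrK.
by apply: le_trans (l2normD _ _) _; rewrite mulr_natl mulr2n lerD.
Qed.

(** Both norms are split over [T] and its complement, and the triangle inequality is applied on each
    part. *)
Lemma l1_cone m (x0 x : 'cV[R]_m) (T : {set 'I_m}) :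
  l1norm x <= l1norm x0 ->
  \sum_(i in ~: T) `|(x - x0) i 0| <=
  \sum_(i in T) `|(x - x0) i 0| + 2 * \sum_(i in ~: T) `|x0 i 0|.
Proof.
rewrite /l1norm (bigID (mem T)) /= [leRHS](bigID (mem T)) /= => H.
have in_setC' (f : 'I_m -> R) :
    \sum_(i in ~: T) f i = \sum_(i | i \notin T) f i.
  by apply: eq_bigl => i; rewrite inE.
rewrite !in_setC'.
have H1 : \sum_(i in T) `|x0 i 0| <=
    \sum_(i in T) `|x i 0| + \sum_(i in T) `|(x - x0) i 0|.
  rewrite -big_split; apply: ler_sum => i _; rewrite !mxE.
  by have := ler_normB (x i 0) (x i 0 - x0 i 0); rewrite subKr.
have H2 : \sum_(i | i \notin T) `|(x - x0) i 0| <=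
    \sum_(i | i \notin T) `|x i 0| + \sum_(i | i \notin T) `|x0 i 0|.
  by rewrite -big_split; apply: ler_sum => i _; rewrite !mxE ler_normB.
lra.
Qed.

(** Cone inequality plus Cauchy-Schwarz on [T]; the factor [sqrt (1/3)] is the ratio of [sqrt S] to
    [sqrt (3 * S)]. *)
Lemma tail_l1 m S (x0 x : 'cV[R]_m) (T : {set 'I_m}) : (0 < S)%N ->
  (#|T| <= S)%N -> l1norm x <= l1norm x0 ->
  (\sum_(i in ~: T) `|(x - x0) i 0|) / Num.sqrt (3 * S)%:R <=
  Num.sqrt (1 / 3) * (l2norm (restr T (x - x0)) +
    2 * ((\sum_(i in ~: T) `|x0 i 0|) / Num.sqrt S%:R)).
Proof.
move=> S0 TS xx0; have := l1_cone T xx0; have := l1_le_l2 (x - x0) TS.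
set l := \sum_(i in T) _; set L := \sum_(i in ~: T) _; set a := l2norm _.
set E := \sum_(i in ~: T) _ => la Ll.
have sS : 0 < Num.sqrt S%:R :> R by rewrite sqrtr_gt0 ltr0n.
have s3 : 0 < Num.sqrt 3 :> R by rewrite sqrtr_gt0.
rewrite natrM sqrtrM // div1r sqrtrV // ler_pdivrMr ?mulr_gt0 //.
have -> : (Num.sqrt 3)^-1 * (a + 2 * (E / Num.sqrt S%:R)) *
  (Num.sqrt 3 * Num.sqrt S%:R) = Num.sqrt S%:R * a + 2 * E :> R.
  by field; rewrite !gt_eqF.
lra.
Qed.

End Program.

(** * The constants and the scalar inequalities behind them *)

Section Constants.
Context {R : realType}.
Implicit Types d : R.

Definition gap d : R := Num.sqrt (1 - d) - Num.sqrt ((1 + d) / 3).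

(* [gap d] vanishes at [d = 1/2]; from there on 500 is
   a crude absolute constant. *)
Definition cst1 d : R :=
  if d < 1 / 2 then 2 * (1 + Num.sqrt (1 / 3)) / gap d else 500.

Definition cst2 d : R :=
  if d < 1 / 2 then
    2 * Num.sqrt ((1 + d) / 3) * (1 + Num.sqrt (1 / 3)) / gap d +
    2 * Num.sqrt (1 / 3)
  else 500.

Lemma gap_gt0 d : d < 1 / 2 -> 0 < gap d.
Proof. by move=> d2; rewrite /gap subr_gt0 ltr_sqrt; lra. Qed.

Lemma cst_ge0 d : 0 <= cst1 d /\ 0 <= cst2 d.
Proof.
rewrite /cst1 /cst2; case: ifP => [/gap_gt0|_]; last by rewrite ler0n.
move: (gap d) => g /ltW g0.
by split; rewrite !(addr_ge0, divr_ge0, mulr_ge0, sqrtr_ge0).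
Qed.

Lemma sqrt_bounds (x lo hi : R) : 0 <= lo -> 0 <= hi -> lo ^+ 2 <= x -> x <= hi ^+ 2 ->
  lo <= Num.sqrt x /\ Num.sqrt x <= hi.
Proof.
move=> lo0 hi0 lx xh; split.
- by rewrite -[lo]ger0_norm // -sqrtr_sqr ler_wsqrtr.
- by rewrite -[hi]ger0_norm // -sqrtr_sqr ler_wsqrtr.
Qed.

Lemma cst_fifth :
  `|cst1 (1 / 5) - 1204 / 100| <= 5 / 1000 /\
  `|cst2 (1 / 5) - 877 / 100| <= 5 / 1000.
Proof.
have d2 : 1 / 5 < 1 / 2 :> R by lra.
have g0 := gap_gt0 d2; rewrite /cst1 /cst2 d2.
have gE : gap (1 / 5) = Num.sqrt (1 - 1 / 5) - Num.sqrt ((1 + 1 / 5) / 3) by [].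
(* Division by the gap, about 0.262, amplifies errors; hence each root is enclosed to within
   4/100000. *)
have [a1 a2] : 265 / 459 <= Num.sqrt (1 / 3) :> R /\
    Num.sqrt (1 / 3) <= 97 / 168 :> R by apply: sqrt_bounds; lra.
have [b1 b2] : 1364 / 1525 <= Num.sqrt (1 - 1 / 5) :> R /\
    Num.sqrt (1 - 1 / 5) <= 161 / 180 :> R by apply: sqrt_bounds; lra.
have [c1 c2] : 117 / 185 <= Num.sqrt ((1 + 1 / 5) / 3) :> R /\
    Num.sqrt ((1 + 1 / 5) / 3) <= 721 / 1140 :> R by apply: sqrt_bounds; lra.
move: gE g0 a1 a2 b1 b2 c1 c2; set g := gap _; set a := Num.sqrt (1 / 3).
set b := Num.sqrt (1 - _); set c := Num.sqrt (_ / 3) => gE g0 a1 a2 b1 b2 c1 c2.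
split; rewrite ler_norml; apply/andP; split.
- by rewrite lerBrDr ler_pdivlMr //; lra.
- by rewrite lerBlDr ler_pdivrMr //; lra.
- suff : 877 / 100 - 5 / 1000 - 2 * a <= 2 * c * (1 + a) / g by lra.
  rewrite ler_pdivlMr //.
  have : 117 / 185 * (1 + 265 / 459) <= c * (1 + a) by apply: ler_pM; lra.
  have : (265 / 459) * g <= a * g by rewrite ler_pM2r.
  lra.
- suff : 2 * c * (1 + a) / g <= 877 / 100 + 5 / 1000 - 2 * a by lra.
  rewrite ler_pdivrMr //.
  have : c * (1 + a) <= 721 / 1140 * (1 + 97 / 168) by apply: ler_pM; lra.
  have : a * g <= (97 / 168) * g by rewrite ler_pM2r.
  lra.
Qed.

(** Roles: [a = |u|], [t = |u + v|], [q] the bound on [|w|], [eta] the scaled [l1] truncation error.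
    Bounding [q] through [a <= t] turns the last hypothesis into an upper bound on [gap d * t]. *)
Lemma stability_small (d3 d eps eta a t q : R) :
  d < 1 / 2 -> d3 <= d -> 0 <= eta -> 0 <= a -> a <= t ->
  q <= Num.sqrt (1 / 3) * (a + 2 * eta) ->
  Num.sqrt (1 - d) * t <= 2 * eps + Num.sqrt (1 + d3) * q ->
  t + q <= cst1 d * eps + cst2 d * eta.
Proof.
move=> d2 d3d eta0 a0 at_ qle Ht; rewrite /cst1 /cst2 d2.
have g0 := gap_gt0 d2.
have rE : Num.sqrt ((1 + d) / 3) = Num.sqrt (1 + d) * Num.sqrt (1 / 3).
  by rewrite [RHS]mulrC -sqrtrM; [congr Num.sqrt; field | lra].
have r3 : Num.sqrt (1 + d3) * q <= Num.sqrt ((1 + d) / 3) * (t + 2 * eta).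
  apply: (@le_trans _ _ (Num.sqrt (1 + d3) * (Num.sqrt (1 / 3) * (a + 2 * eta)))).
    by rewrite ler_wpM2l ?sqrtr_ge0.
  rewrite rE -mulrA; apply: ler_pM; rewrite ?sqrtr_ge0 //.
  - by rewrite mulr_ge0 ?sqrtr_ge0 //; lra.
  - by apply: ler_wsqrtr; lra.
  - by rewrite ler_wpM2l ?sqrtr_ge0 //; lra.
have tle : t <= (2 * eps + 2 * Num.sqrt ((1 + d) / 3) * eta) / gap d.
  by rewrite ler_pdivlMr // /gap; lra.
have r0 : 0 <= Num.sqrt (1 / 3) :> R by exact: sqrtr_ge0.
have : (1 + Num.sqrt (1 / 3)) * t <= (1 + Num.sqrt (1 / 3)) *
    ((2 * eps + 2 * Num.sqrt ((1 + d) / 3) * eta) / gap d).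
  by rewrite ler_wpM2l //; lra.
have : Num.sqrt (1 / 3) * a <= Num.sqrt (1 / 3) * t by rewrite ler_wpM2l.
lra.
Qed.

(** Same roles, with [b = |v|]; the last hypothesis is the expansion of [|A u|^2]. *)
Lemma stability_large (d3 d eps eta a b t q : R) :
  0 <= d3 -> 1 / 2 <= d -> d3 + 3 * d < 2 -> 0 <= eps -> 0 <= eta ->
  0 <= a -> 0 <= b -> 0 <= t -> t ^+ 2 = a ^+ 2 + b ^+ 2 ->
  q <= Num.sqrt (1 / 3) * (a + 2 * eta) ->
  Num.sqrt (1 - d) * t <= 2 * eps + Num.sqrt (1 + d3) * q ->
  (1 - d3) * a ^+ 2 <= 2 * a * (2 * eps) + d * a * b + d * a * q ->
  t + q <= 500 * eps + 500 * eta.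
Proof.
move=> d30 d2 dd eps0 eta0 a0 b0 t0 tE qle Ht Ha.
have [_ r6] : 0 <= Num.sqrt (1 / 3) :> R /\ Num.sqrt (1 / 3) <= 6 / 10 :> R.
  by apply: sqrt_bounds; lra.
have q6 : q <= 6 / 10 * (a + 2 * eta).
  by apply: le_trans qle _; rewrite ler_wpM2r //; lra.
have at_ : a <= t by rewrite -ler_sqr ?nnegrE // tE lerDl sqr_ge0.
have tab : t <= a + b.
  by rewrite -ler_sqr ?nnegrE ?addr_ge0 // tE; have := mulr_ge0 a0 b0; nra.
have [ba|ba] := leP (a / 3) b.
  set s := Num.sqrt (1 - d) in Ht *.
  have s2 : 1 / 2 <= s.
    have -> : 1 / 2 = Num.sqrt ((1 / 2) ^+ 2) :> R by rewrite sqrtr_sqr ger0_norm; lra.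
    by apply: ler_wsqrtr; lra.
  (* The hypothesis [d3 + 3 * d < 2] says exactly [(1 + d3) / 3 < 1 - d]. *)
  have q3 : Num.sqrt (1 + d3) * q <= s * (a + 2 * eta).
    apply: (@le_trans _ _ (Num.sqrt (1 + d3) * (Num.sqrt (1 / 3) * (a + 2 * eta)))).
      by rewrite ler_wpM2l ?sqrtr_ge0.
    rewrite mulrA ler_wpM2r //; first by lra.
    by rewrite [leLHS]mulrC -sqrtrM; [apply: ler_wsqrtr; lra | lra].
  (* From [b >= a / 3], [t^2 >= (10/9) a^2], and [9/10 <= (95/100)^2]. *)
  have a95 : a <= 95 / 100 * t.
    by rewrite -ler_sqr ?nnegrE ?mulr_ge0 //; [nra | lra].
  have H : s * (5 / 100 * t - 2 * eta) <= 2 * eps by nra.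
  have [] : 5 / 100 * t - 2 * eta <= 0 \/ 0 <= 5 / 100 * t - 2 * eta by lra.
    lra.
  move=> p0; have : 1 / 2 * (5 / 100 * t - 2 * eta) <= s * (5 / 100 * t - 2 * eta).
    by rewrite ler_wpM2r.
  lra.
(* Here [b < a / 3], so [a = 0] would make [b] negative. *)
have [a_0|a_0] := eqVneq a 0; first by lra.
have ap : 0 < a by rewrite lt_def a_0.
have H1 : (1 - d3) * a <= 4 * eps + d * (b + q).
  by rewrite -(ler_pM2l ap); lra.
(* [1 - d3 > 3 * d - 1 >= d], as [d >= 1/2]. *)
have H2 : d * a <= (1 - d3) * a by rewrite ler_wpM2r //; lra.
have H3 : d * (b + q) <= d * (a / 3 + 6 / 10 * (a + 2 * eta)).
  by rewrite ler_wpM2l; lra.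
(* What is left of [a] is [1 - 1/3 - 6/10 = 1/15], with [6/10] an upper bound for [sqrt (1/3)]. *)
have H4 : d * (a / 15 - 12 / 10 * eta) <= 4 * eps by lra.
have [] : a / 15 - 12 / 10 * eta <= 0 \/ 0 <= a / 15 - 12 / 10 * eta by lra.
  lra.
move=> p0; have : 1 / 2 * (a / 15 - 12 / 10 * eta) <= d * (a / 15 - 12 / 10 * eta).
  by rewrite ler_wpM2r.
lra.
Qed.

End Constants.

(** * The error bound for given isometry constants, and the theorem *)

Lemma stability (R : realType) (n m S : nat) (A : 'M[R]_(n, m))
    (d3 d4 eps : R) (x0 xs : 'cV[R]_m) (e y : 'cV[R]_n) (T : {set 'I_m}) :
  (0 < S)%N -> rip A (3 * S) d3 -> rip A (4 * S) d4 ->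
  0 <= d3 -> d3 <= d4 -> d3 + 3 * d4 < 2 -> 0 <= eps -> (#|T| <= S)%N ->
  l2norm e <= eps -> y = A *m x0 + e -> P2_solution A y eps xs ->
  l2norm (xs - x0) <= cst1 d4 * eps +
    cst2 d4 * ((\sum_(i in ~: T) `|x0 i 0|) / Num.sqrt S%:R).
Proof.
move=> S0 A3 A4 d30 d34 dd eps0 TS ee yE sol.
have tube := P2_tube ee yE sol.
have xx0 : l1norm xs <= l1norm x0.
  (* [x0] is feasible: its residual is [- e]. *)
  by apply: sol.2; rewrite /P2_feasible yE opprD addNKr l2normN.
have qle := tail_l1 S0 TS xx0.
have := block_decomposition (xs - x0) S0 A3 A4 TS.
set h := xs - x0 in tube qle *; set u := restr T h in qle *.
set q := _ / Num.sqrt (3 * S)%:R in qle *.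
set eta := _ / Num.sqrt S%:R in qle *.
have eta0 : 0 <= eta by rewrite divr_ge0 ?sqrtr_ge0 // sumr_ge0.
move=> [v [w [hE [tE [wq [Awq [Auv [cuv cuw]]]]]]]].
have a0 := l2norm_ge0 u; have b0 := l2norm_ge0 v.
have t0 := l2norm_ge0 (u + v).
have Ht : Num.sqrt (1 - d4) * l2norm (u + v) <= 2 * eps + Num.sqrt (1 + d3) * q.
  apply: le_trans Auv _.
  have -> : A *m (u + v) = A *m h + - (A *m w).
    by rewrite hE !mulmxDr addrK.
  by apply: le_trans (l2normD _ _) _; rewrite l2normN lerD.
have at_ : l2norm u <= l2norm (u + v).
  by rewrite -ler_sqr ?nnegrE // tE lerDl sqr_ge0.
rewrite {1}hE; apply: le_trans (l2normD _ _) _.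
apply: le_trans (lerD (lexx _) wq) _.
have [d2|d2] := ltP d4 (1 / 2).
  exact: (stability_small d2 d34 eta0 a0 at_ qle Ht).
have -> : cst1 d4 = 500 by rewrite /cst1 ltNge d2.
have -> : cst2 d4 = 500 by rewrite /cst2 ltNge d2.
apply: (stability_large d30 d2 dd eps0 eta0 a0 b0 t0 tE qle Ht).
have T3 : (#|T| <= 3 * S)%N by rewrite (leq_trans TS) // leq_pmull.
have uT : supported T u by exact: supported_restr.
have [Hu _] := rip_supported A3 T3 uT.
apply: le_trans Hu _.
have Auu : l2norm (A *m u) ^+ 2 = dot (A *m u) (A *m h) +
    - dot (A *m u) (A *m v) + - dot (A *m u) (A *m w).
  by rewrite hE l2norm_sqr_dot !mulmxDr !dotDr; ring.
rewrite {}Auu; have d40 : 0 <= d4 by lra.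
apply: lerD (cuw d40); apply: lerD cuv; apply: le_trans (dot_le _ _) _.
(* Crude bound: [1 + d3 <= 4]. *)
have Au2 : l2norm (A *m u) <= 2 * l2norm u.
  apply: le_trans (rip_le_norm A3 T3 uT) _; rewrite ler_wpM2r //.
  by apply: (sqrt_bounds (lexx 0) _ _ _).2; lra.
by apply: ler_pM; rewrite ?l2norm_ge0.
Qed.

Lemma rip_leq (R : realType) (n m : nat) (A : 'M[R]_(n, m)) (k l : nat) (d : R) :
  (k <= l)%N -> rip A l d -> rip A k d.
Proof. by move=> kl Ad T c Tk; apply: Ad; apply: leq_trans kl. Qed.

Theorem theorem2 (R : realType) :
  exists C1 C2 : R -> R,
    (forall (n m S : nat) (A : 'M[R]_(n, m)) (eps : R)
       (x0 x0S xsharp : 'cV[R]_m) (e y : 'cV[R]_n),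
       (1 <= S)%N ->
       ric A (3 * S) + 3 * ric A (4 * S) < 2 ->
       0 <= eps ->
       is_truncation S x0 x0S ->
       l2norm e <= eps ->
       y = A *m x0 + e ->
       P2_solution A y eps xsharp ->
       l2norm (xsharp - x0) <=
         C1 (ric A (4 * S)) * eps +
         C2 (ric A (4 * S)) * (l1norm (x0 - x0S) / Num.sqrt S%:R)) /\
    `|C1 (1 / 5) - 1204 / 100| <= 5 / 1000 /\
    `|C2 (1 / 5) - 877 / 100| <= 5 / 1000.
Proof.
exists cst1, cst2; split; last exact: cst_fifth.
move=> n m S A eps x0 x0S xs e y S1 dd eps0 [T [cT _ xSE]] ee yE sol.
(* For [m = 0], [ric] is only a default value, but the error vanishes and the constants are
   nonnegative. *)
case: (posnP m) => [m0|m0].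
  have [c1 c2] := cst_ge0 (ric A (4 * S)).
  have -> : xs - x0 = 0.
    by apply/matrixP => -[i im]; exfalso; rewrite m0 in im.
  by rewrite l2norm0 addr_ge0 // mulr_ge0 // divr_ge0 ?sqrtr_ge0 // sumr_ge0.
have S3 : (0 < 3 * S)%N by rewrite muln_gt0.
have S4 : (0 < 4 * S)%N by rewrite muln_gt0.
have [A3 min3] := ricP A m0 S3; have [A4 _] := ricP A m0 S4.
have -> : l1norm (x0 - x0S) = \sum_(i in ~: T) `|x0 i 0|.
  rewrite [RHS]big_mkcond; apply: eq_bigr => i _; rewrite xSE !mxE inE.
  by case: (i \in T); rewrite ?subr0 ?subrr ?normr0.
apply: (stability S1 A3 A4 _ _ dd eps0 _ ee yE sol).
- exact: rip_ge0 m0 S3 A3.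
- by apply: min3; apply: rip_leq A4; rewrite leq_mul2r orbT.
- by rewrite cT geq_minl.
Qed.
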